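(* Let $q$ be an odd prime power, and let $\mathcal{S}_l,\mathcal{S}_g,\mathcal{NS}_l,\mathcal{NS}_g,\mathcal{O}_l,\mathcal{O}_g$ be the sets of planes of the Klein quadric $\mathcal{K}=\mathcal{Q}^+(5,q)$ defined in the context. (1) If $q\equiv 1 \pmod 4$, then $\mathcal{S}_l\cup \mathcal{S}_g$, $\mathcal{NS}_l\cup \mathcal{NS}_g$ and $\mathcal{O}_l\cup \mathcal{O}_g$ are degree one Cameron-Liebler sets of planes in $\mathcal{K}$, with parameter $\frac{q(q-1)}{2}$, $\frac{q(q-1)}{2}$ and $q+1$ respectively. (2) If $q\equiv 3 \pmod 4$, then $\mathcal{S}_l\cup \mathcal{NS}_g$, $\mathcal{S}_g\cup \mathcal{NS}_l$ and $\mathcal{O}_l\cup \mathcal{O}_g$ are degree one Cameron-Liebler sets of planes in $\mathcal{K}$, with parameter $\frac{q(q-1)}{2}$, $\frac{q(q-1)}{2}$ and $q+1$ respectively.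
   Context: Points, lines and planes of a projective space are the vector subspaces of dimension $1,2,3$. Let $\kappa$ be the Klein correspondence, the bijection (via Plücker coordinates) from the lines of $\mathrm{PG}(3,q)$ to the points of the Klein quadric $\mathcal{K}=\mathcal{Q}^+(5,q)$, a hyperbolic quadric in $\mathrm{PG}(5,q)$. The generators of $\mathcal{K}$ (maximal totally singular subspaces) are planes, of two kinds: Latin planes, whose points are the $\kappa$-images of the lines through a fixed point of $\mathrm{PG}(3,q)$, and Greek planes, whose points are the $\kappa$-images of the lines in a fixed plane of $\mathrm{PG}(3,q)$. Let $Q\cong\mathcal{Q}^+(3,q)$ be the hyperbolic quadric of $\mathrm{PG}(3,q)$ with equation $X_0X_1+X_2X_3=0$, $q$ odd, and let $\perp$ be the polarity of $\mathrm{PG}(3,q)$ associated with $Q$. A point $P(x_0,x_1,x_2,x_3)$ is a square point if $x_0x_1+x_2x_3$ is a non-zero square in $\mathbb{F}_q$, and a non-square point if $x_0x_1+x_2x_3$ is a non-square in $\mathbb{F}_q$. For a point $P$ of $\mathrm{PG}(3,q)$ let $\pi^P_l$ be the Latin plane that is the image under $\kappa$ of the set of lines through $P$, and let $\pi^P_g$ be the Greek plane that is the image under $\kappa$ of the set of lines in the plane $P^\perp$. Put $\mathcal{S}_l=\{\pi^P_l : P \text{ a square point}\}$, $\mathcal{NS}_l=\{\pi^P_l : P \text{ a non-square point}\}$, $\mathcal{O}_l=\{\pi^P_l : P\in Q\}$, $\mathcal{S}_g=\{\pi^P_g : P \text{ a square point}\}$, $\mathcal{NS}_g=\{\pi^P_g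 : P \text{ a non-square point}\}$, $\mathcal{O}_g=\{\pi^P_g : P\in Q\}$. Degree one Cameron-Liebler sets. Let $\Omega_1$ and $\Omega_3$ be the sets of points and of planes of $\mathcal{K}$, and let $C_{1,3}:\mathbb{R}^{\Omega_1}\to\mathbb{R}^{\Omega_3}$ be the incidence map (its matrix has rows indexed by planes, columns by points, with entry 1 if the point lies in the plane and 0 otherwise). Let $\boldsymbol{j}\in\mathbb{R}^{\Omega_3}$ be the all-ones vector, $V_0=\langle \boldsymbol{j}\rangle$ and $V_1=\mathrm{Im}(C_{1,3})\cap\langle\boldsymbol{j}\rangle^\perp$. A set $\mathcal{L}\subseteq\Omega_3$ is a degree one Cameron-Liebler set if its characteristic vector lies in $V_0\oplus V_1$ $(=\mathrm{Im}(C_{1,3}))$. Its parameter is $x=|\mathcal{L}|/\prod_{i=0}^{1}(q^{i}+1)=|\mathcal{L}|/(2(q+1))$. *)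

(* Defs.v *)
From HB Require Import structures.
From mathcomp Require Import all_boot all_order all_algebra.
From mathcomp Require Import reals.
From mathcomp Require Import ring.

Set Implicit Arguments.
Unset Strict Implicit.
Unset Printing Implicit Defensive.
Import Order.TTheory GRing.Theory Num.Theory.
Local Open Scope ring_scope.

Import VectorInternalTheory.
HB.instance Definition _ (F : finFieldType) (vT : vectType F) :=
  [Countable of {vspace vT} by <:].
HB.instance Definition _ (F : finFieldType) (vT : vectType F) :=
  [Finite of {vspace vT} by <:].

Definition crd (F : fieldType) n (x : 'rV[F]_n.+1) (i : nat) : F :=
  x 0 (inord i).
Arguments crd {F n} x i%_N.

Section ProjectiveSpace.
Variable F : finFieldType.

(* Points, lines and planes of PG(n-1, q) are the subspaces of 'rV[F]_n of
   vector space dimension 1, 2 and 3. *)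
Definition subspaces (n k : nat) : {set {vspace 'rV[F]_n}} :=
  [set U : {vspace 'rV[F]_n} | \dim U == k].
Definition pg_points (n : nat) := subspaces n 1.
Definition pg_lines (n : nat) := subspaces n 2.

Definition totally_singular n (f : 'rV[F]_n -> F) (U : {vspace 'rV[F]_n}) :=
  [forall x in U, f x == 0].

(* Equation of Q^+(3, q) in PG(3, q). *)
Definition formQ (x : 'rV[F]_4) : F :=
  crd x 0 * crd x 1 + crd x 2 * crd x 3.

Definition is_square (c : F) : bool := [exists a : F, a ^+ 2 == c].

Definition square_points : {set {vspace 'rV[F]_4}} :=
  [set P in pg_points 4 | [exists x : 'rV[F]_4,
     [&& P == <[x]>%VS, formQ x != 0 & is_square (formQ x)]]].
Definition nonsquare_points : {set {vspace 'rV[F]_4}} :=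
  [set P in pg_points 4 | [exists x : 'rV[F]_4,
     (P == <[x]>%VS) && ~~ is_square (formQ x)]].
Definition quadric_points : {set {vspace 'rV[F]_4}} :=
  [set P in pg_points 4 | totally_singular formQ P].

(* The symmetric bilinear form obtained by polarizing formQ. *)
Definition bilQ (x y : 'rV[F]_4) : F := formQ (x + y) - formQ x - formQ y.

Fact bilQ_linear x : linear (bilQ x : 'rV[F]_4 -> F^o).
Proof.
move=> a y z; rewrite /bilQ /formQ /crd !mxE /= -[a *: _]/(a * _); ring.
Qed.
HB.instance Definition _ x :=
  GRing.isLinear.Build F 'rV[F]_4 F^o _ (bilQ x : 'rV[F]_4 -> F^o)
    (bilQ_linear x).

Definition perpQ (U : {vspace 'rV[F]_4}) : {vspace 'rV[F]_4} :=
  (\bigcap_(x : 'rV[F]_4 | x \in U)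
     lker (linfun (bilQ x : 'rV[F]_4 -> F^o)))%VS.

Lemma mem_perpQ (U : {vspace 'rV[F]_4}) (y : 'rV[F]_4) :
  (y \in perpQ U) = [forall x in U, bilQ x y == 0].
Proof.
apply/idP/forall_inP => [yU x xU | yU].
  have /subvP/(_ y yU) := @bigcapv_inf _ _ _ x (fun x => x \in U)
    (fun x => lker (linfun (bilQ x : 'rV[F]_4 -> F^o))) _ xU (subvv _).
  by rewrite memv_ker lfunE.
rewrite memvE; apply/subv_bigcapP => x xU.
by rewrite -memvE memv_ker lfunE /= yU.
Qed.

(* Pluecker coordinates in the order (p01, p23, p02, p31, p03, p12). *)
Definition plucker (u v : 'rV[F]_4) : 'rV[F]_6 :=
  let p i j := crd u i * crd v j - crd u j * crd v i in
  \row_(k < 6) [:: p 0 1; p 2 3; p 0 2; p 3 1; p 0 3; p 1 2]%N`_k.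

(* Equation of the Klein quadric in these coordinates. *)
Definition formK (x : 'rV[F]_6) : F :=
  crd x 0 * crd x 1 + crd x 2 * crd x 3 + crd x 4 * crd x 5.

(* Only meaningful when \dim L = 2; kappaE shows that the choice of the
   basis of L is immaterial. *)
Definition kappa (L : {vspace 'rV[F]_4}) : {vspace 'rV[F]_6} :=
  <[plucker (vbasis L)`_0 (vbasis L)`_1]>%VS.

Lemma formK_plucker u v : formK (plucker u v) = 0.
Proof. rewrite /formK /crd !mxE /= !inordK //= /crd; ring. Qed.

Lemma plucker_comb a b c d u v :
  plucker (a *: u + b *: v) (c *: u + d *: v) =
  (a * d - b * c) *: plucker u v.
Proof.
apply/rowP => k; rewrite !mxE /crd.
by case: k => [[|[|[|[|[|[|//]]]]]] ?] /=; rewrite !mxE; ring.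
Qed.

Lemma plucker_span u v x y : x \in <<[:: u; v]>>%VS -> y \in <<[:: u; v]>>%VS ->
  plucker x y \in <[plucker u v]>%VS.
Proof.
rewrite span_cons span_seq1.
move=> /memv_addP[_ /vlineP[a ->] [_ /vlineP[b ->] ->]].
move=> /memv_addP[_ /vlineP[c ->] [_ /vlineP[d ->] ->]].
by rewrite plucker_comb memvZ ?memv_line.
Qed.

Lemma kappaE (L : {vspace 'rV[F]_4}) (u v : 'rV[F]_4) :
  \dim L = 2%N -> L = <<[:: u; v]>>%VS -> kappa L = <[plucker u v]>%VS.
Proof.
move=> dL Luv; rewrite /kappa.
have sz : size (vbasis L) = 2%N by rewrite size_tuple.
have := span_basis (vbasisP L).
case: (tval (vbasis L)) sz => [|x [|y [|]]] //= _ Lxy.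
apply/eqP; rewrite eqEsubv -!memvE; apply/andP; split; apply: plucker_span.
- by rewrite -Luv -Lxy memv_span ?mem_head.
- by rewrite -Luv -Lxy memv_span // !inE eqxx orbT.
- by rewrite Lxy Luv memv_span ?mem_head.
- by rewrite Lxy Luv memv_span // !inE eqxx orbT.
Qed.

(* The points (k = 1) and planes (k = 3) of the Klein quadric. *)
Definition Omega (k : nat) : finType :=
  {U : {vspace 'rV[F]_6} | (\dim U == k) && totally_singular formK U}.

Definition points_in (pi : Omega 3) : {set {vspace 'rV[F]_6}} :=
  [set X in pg_points 6 | (X <= val pi)%VS].

Definition lines_through (P : {vspace 'rV[F]_4}) :=
  [set L in pg_lines 4 | (P <= L)%VS].
Definition lines_inside (E : {vspace 'rV[F]_4}) :=
  [set L in pg_lines 4 | (L <= E)%VS].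

(* is_latin P pi : pi is the plane pi^P_l;
   is_greek P pi : pi is the plane pi^P_g. *)
Definition is_latin (P : {vspace 'rV[F]_4}) (pi : Omega 3) : bool :=
  points_in pi == kappa @: lines_through P.
Definition is_greek (P : {vspace 'rV[F]_4}) (pi : Omega 3) : bool :=
  points_in pi == kappa @: lines_inside (perpQ P).

Definition latin_planes (A : {set {vspace 'rV[F]_4}}) : {set Omega 3} :=
  [set pi | [exists P in A, is_latin P pi]].
Definition greek_planes (A : {set {vspace 'rV[F]_4}}) : {set Omega 3} :=
  [set pi | [exists P in A, is_greek P pi]].

Definition S_l := latin_planes square_points.
Definition NS_l := latin_planes nonsquare_points.
Definition O_l := latin_planes quadric_points.
Definition S_g := greek_planes square_points.
Definition NS_g := greek_planes nonsquare_points.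
Definition O_g := greek_planes quadric_points.

End ProjectiveSpace.

Section CameronLiebler.
Variables (F : finFieldType) (R : realType).

Local Notation VP := ({ffun Omega F 1 -> R^o}).
Local Notation VL := ({ffun Omega F 3 -> R^o}).

Definition incidence (f : VP) : VL :=
  [ffun pi => \sum_(X : Omega F 1) (val X <= val pi)%VS%:R * f X].

Fact incidence_linear : linear incidence.
Proof.
move=> a f g; apply/ffunP => pi; rewrite !ffunE scaler_sumr -big_split /=.
by apply: eq_bigr => X _; rewrite !ffunE -![a *: _]/(a * _); ring.
Qed.
HB.instance Definition _ := GRing.isLinear.Build R VP VL _ incidence
  incidence_linear.

Definition allones : VL := [ffun=> 1].

Definition dotj (g : VL) : R^o :=
  \sum_(pi : Omega F 3) allones pi * g pi.

Fact dotj_linear : linear dotj.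
Proof.
move=> a f g; rewrite /dotj scaler_sumr -big_split /=.
by apply: eq_bigr => pi _; rewrite !ffunE -![a *: _]/(a * _); ring.
Qed.
HB.instance Definition _ := GRing.isLinear.Build R VL R^o _ dotj dotj_linear.

Definition V0 : {vspace VL} := <[allones]>%VS.
(* lker (linfun dotj) is the orthogonal complement of allones. *)
Definition V1 : {vspace VL} :=
  (limg (linfun incidence) :&: lker (linfun dotj))%VS.

Definition charvec (L : {set Omega F 3}) : VL := [ffun pi => (pi \in L)%:R].

Definition degree_one_CL (L : {set Omega F 3}) : Prop :=
  charvec L \in (V0 + V1)%VS.

Definition CL_parameter (L : {set Omega F 3}) : R :=
  #|L|%:R / \prod_(i < 2) (#|F|%:R ^+ i + 1).

Definition CL_with_parameter (L : {set Omega F 3}) (x : R) : Prop :=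
  degree_one_CL L /\ CL_parameter L = x.

End CameronLiebler.

(* Main.v *)
(* A weight on the points of the Klein quadric is attached to every function phi
   on F that is invariant under multiplication by nonzero squares: the point
   kappa(L) gets the sum of phi(Q(v)) over the vectors v of the line L.  Summing over
   the lines through a point <x>, or over the lines in x^⊥, reduces to sums of
   phi(Q(v)) over F^4, over <x> and over x^⊥; by the identity
   sum_(m, n) phi(m n + s) = (q - 1) * sum_t phi(t) + q * phi(s) the two results are
   the same constant plus the same nonzero multiple of phi(Q(x)), respectively of
   phi(- Q(x)).  As constant functions arise too, the function equal to phi(Q(x)) on
   the Latin plane and to phi(- Q(x)) on the Greek plane of each point <x> lies in
   the image of the incidence map.  Taking for phi the indicator functions of the
   nonzero squares, of the non-squares and of 0 gives all the sets of the theorem: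
   whether t and - t are both squares is decided by q modulo 4. *)
Require Import Defs.
From HB Require Import structures.
From mathcomp Require Import all_boot all_order all_algebra all_field.
From mathcomp Require Import reals ring lra zify.

Set Implicit Arguments.
Unset Strict Implicit.
Unset Printing Implicit Defensive.
Import Order.TTheory GRing.Theory Num.Theory.
Local Open Scope ring_scope.

(** * Coordinates *)

Section Coordinates.
Variable F : fieldType.
Implicit Types (u v w x y e : 'rV[F]_4) (z : 'rV[F]_6).

Definition dot e x : F :=
  crd e 0 * crd x 0 + crd e 1 * crd x 1 + crd e 2 * crd x 2 + crd e 3 * crd x 3.

(** The Gram matrix of [bilQ] applied to [x]; as a linear form it defines the polar plane of [x]. *)
Definition flip x : 'rV[F]_4 :=
  \row_(k < 4) [:: crd x 1; crd x 0; crd x 3; crd x 2]`_k.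

(** The Hodge star in Pluecker coordinates, which interchanges lines through a point and lines in a
    plane. *)
Definition swap z : 'rV[F]_6 :=
  \row_(k < 6) [:: crd z 1; crd z 0; crd z 3; crd z 2; crd z 5; crd z 4]`_k.

(* [hook e z] is the product of the row [e] with the alternating matrix whose upper
   entries are the Pluecker coordinates [z]; for [z = plucker u w] it is the
   contraction [hook_plucker].  Replacing [z] by its dual [swap z] gives [wedge], the
   trivector [v ∧ z] read as a linear form, which vanishes when the line with Pluecker
   coordinates [z] passes through [v]. *)
Definition hook e z : 'rV[F]_4 :=
  \row_(k < 4) [::
    - crd e 1 * crd z 0 - crd e 2 * crd z 2 - crd e 3 * crd z 4;
    crd e 0 * crd z 0 - crd e 2 * crd z 5 + crd e 3 * crd z 3;
    crd e 0 * crd z 2 + crd e 1 * crd z 5 - crd e 3 * crd z 1;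
    crd e 0 * crd z 4 - crd e 1 * crd z 3 + crd e 2 * crd z 1]`_k.

Definition wedge v z := hook v (swap z).

Lemma row4P (x y : 'rV[F]_4) : crd x 0 = crd y 0 -> crd x 1 = crd y 1 ->
  crd x 2 = crd y 2 -> crd x 3 = crd y 3 -> x = y.
Proof.
rewrite /crd => *; apply/rowP => -[[|[|[|[|//]]]]] lt_k;
  by rewrite -(inord_val (Ordinal lt_k)).
Qed.

Lemma row6P (x y : 'rV[F]_6) : crd x 0 = crd y 0 -> crd x 1 = crd y 1 ->
  crd x 2 = crd y 2 -> crd x 3 = crd y 3 -> crd x 4 = crd y 4 ->
  crd x 5 = crd y 5 -> x = y.
Proof.
rewrite /crd => *; apply/rowP => -[[|[|[|[|[|[|//]]]]]]] lt_k;
  by rewrite -(inord_val (Ordinal lt_k)).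
Qed.

Lemma crdD n (x y : 'rV[F]_n.+1) i : crd (x + y) i = crd x i + crd y i.
Proof. by rewrite /crd mxE. Qed.
Lemma crdN n (x : 'rV[F]_n.+1) i : crd (- x) i = - crd x i.
Proof. by rewrite /crd mxE. Qed.
Lemma crdZ n a (x : 'rV[F]_n.+1) i : crd (a *: x) i = a * crd x i.
Proof. by rewrite /crd mxE. Qed.
Lemma crd0 n i : crd (0 : 'rV[F]_n.+1) i = 0.
Proof. by rewrite /crd mxE. Qed.
Lemma crd_row n (s : seq F) i : (i < n.+1)%N ->
  crd (\row_(k < n.+1) s`_k) i = s`_i.
Proof. by move=> lt_i; rewrite /crd mxE inordK. Qed.

Lemma crd_flip x : (crd (flip x) 0 = crd x 1) * (crd (flip x) 1 = crd x 0) *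
  (crd (flip x) 2 = crd x 3) * (crd (flip x) 3 = crd x 2).
Proof. by rewrite !crd_row. Qed.

Lemma crd_swap z : (crd (swap z) 0 = crd z 1) * (crd (swap z) 1 = crd z 0) *
  (crd (swap z) 2 = crd z 3) * (crd (swap z) 3 = crd z 2) *
  (crd (swap z) 4 = crd z 5) * (crd (swap z) 5 = crd z 4).
Proof. by rewrite !crd_row. Qed.

Lemma crd_hook e z :
  (crd (hook e z) 0 =
     - crd e 1 * crd z 0 - crd e 2 * crd z 2 - crd e 3 * crd z 4) *
  (crd (hook e z) 1 =
     crd e 0 * crd z 0 - crd e 2 * crd z 5 + crd e 3 * crd z 3) *
  (crd (hook e z) 2 =
     crd e 0 * crd z 2 + crd e 1 * crd z 5 - crd e 3 * crd z 1) *
  (crd (hook e z) 3 =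
     crd e 0 * crd z 4 - crd e 1 * crd z 3 + crd e 2 * crd z 1).
Proof. by rewrite !crd_row. Qed.
End Coordinates.

Lemma crd_plucker (F : finFieldType) (u v : 'rV[F]_4) :
  (crd (plucker u v) 0 = crd u 0 * crd v 1 - crd u 1 * crd v 0) *
  (crd (plucker u v) 1 = crd u 2 * crd v 3 - crd u 3 * crd v 2) *
  (crd (plucker u v) 2 = crd u 0 * crd v 2 - crd u 2 * crd v 0) *
  (crd (plucker u v) 3 = crd u 3 * crd v 1 - crd u 1 * crd v 3) *
  (crd (plucker u v) 4 = crd u 0 * crd v 3 - crd u 3 * crd v 0) *
  (crd (plucker u v) 5 = crd u 1 * crd v 2 - crd u 2 * crd v 1).
Proof. by rewrite !crd_row. Qed.

(** Expands coordinates of compound vectors down to those of variables; [coords] then checks vector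
    identities as polynomial identities. *)
Ltac coords_eval :=
  rewrite ?/bilQ ?/wedge ?/dot ?/formK ?/formQ;
  repeat match goal with
  | |- context [crd (?x + ?y) ?i] => rewrite !(crdD x y)
  | |- context [crd 0 ?i] => rewrite (crd0 _ _ i)
  | |- context [crd (- ?x) ?i] => rewrite !(crdN x)
  | |- context [crd (?a *: ?x) ?i] => rewrite !(crdZ a x)
  | |- context [crd (hook ?e ?z) ?i] => rewrite ?(crd_hook e z)
  | |- context [crd (flip ?z) ?i] => rewrite ?(crd_flip z)
  | |- context [crd (swap ?z) ?i] => rewrite ?(crd_swap z)
  | |- context [crd (plucker ?u ?v) ?i] => rewrite ?(crd_plucker u v)
  end.
Ltac coords_ring :=
  coords_eval;
  repeat match goal with |- context [crd ?x ?i] => generalize (crd x i); intro end;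
  ring.
Ltac coords := (apply: row4P || apply: row6P || idtac); coords_ring.

(** * Exterior algebra identities in dimension four *)

Section Identities.
Variable F : finFieldType.
Implicit Types (u v w x y e : 'rV[F]_4) (z : 'rV[F]_6).

Lemma bilQ_dot x y : bilQ x y = dot (flip x) y.
Proof. coords. Qed.

Lemma dotC x y : dot x y = dot y x.
Proof. coords. Qed.

Lemma flipK : involutive (@flip F).
Proof. move=> x; coords. Qed.

Lemma swapK : involutive (@swap F).
Proof. move=> x; coords. Qed.

Lemma formK_swap z : formK (swap z) = formK z.
Proof. coords. Qed.

Lemma hook_linear e : linear (hook e).
Proof. move=> a z z'; coords. Qed.
HB.instance Definition _ e :=
  GRing.isLinear.Build F 'rV[F]_6 'rV[F]_4 _ (hook e) (hook_linear e).

Lemma wedge_linear v : linear (wedge v).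
Proof. move=> a z z'; coords. Qed.
HB.instance Definition _ v :=
  GRing.isLinear.Build F 'rV[F]_6 'rV[F]_4 _ (wedge v) (wedge_linear v).

Lemma plucker_linear x : linear (plucker x).
Proof. move=> a y y'; coords. Qed.
HB.instance Definition _ x :=
  GRing.isLinear.Build F 'rV[F]_4 'rV[F]_6 _ (plucker x) (plucker_linear x).

(** Leibniz rule for contracting [x ∧ z] by the form [e]. If [wedge x z = 0] and [dot x e = 1], it
    writes [z] as a line through [x]. *)
Lemma plucker_hook x e z :
  plucker x (hook e z) = dot x e *: z - swap (plucker e (wedge x z)).
Proof. coords. Qed.

Lemma hook_plucker e u w :
  hook e (plucker u w) = dot e u *: w - dot e w *: u.
Proof. coords. Qed.

Lemma wedge_plucker u w : wedge u (plucker u w) = 0.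
Proof. coords. Qed.

(** For singular [z] and [dot (hook e z) e' = 1], this exhibits [z] as the line joining two of its
    contractions. *)
Lemma plucker_hook2 e e' z :
  plucker (hook e z) (hook e' z) =
    dot (hook e z) e' *: z - formK z *: swap (plucker e e').
Proof. coords. Qed.

(** When [wedge v z = 0], this expresses [v] by two contractions of [z]; if [z] is a line they lie
    on it, and so does [v]. *)
Lemma dot_hook_scale e e' v z :
  dot (hook e z) e' *: v =
    dot v e' *: hook e z - dot v e *: hook e' z
    - wedge (wedge v z) (plucker e e').
Proof. coords. Qed.

(** An alternating matrix of order 4 times its dual is, up to sign, its Pfaffian [formK] times the
    identity. *)
Lemma hook_wedge v z : hook (wedge v z) z = - formK z *: v.
Proof. coords. Qed.

(** The product [v ∧ w ∧ z] is the polar form of [formK]; between two lines it vanishes when they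
    meet. *)
Lemma dot_wedge v w z :
  dot (wedge v z) w = formK (z + plucker v w) - formK z - formK (plucker v w).
Proof. coords. Qed.

End Identities.

(** * Latin and Greek planes *)

Section Geometry.
Variable F : finFieldType.
Implicit Types (u v w x y e : 'rV[F]_4) (z : 'rV[F]_6).

(* For [x <> 0], [lat x] and [grk x] are the Latin and the Greek plane of the point
   [<[x]>]; [lat 0] is the whole space. *)
Definition lat v : {vspace 'rV[F]_6} := lker (linfun (wedge v)).
Definition grk x : {vspace 'rV[F]_6} := lker (linfun (hook (flip x))).

Lemma mem_lat v z : (z \in lat v) = (wedge v z == 0).
Proof. by rewrite memv_ker lfunE. Qed.

Lemma mem_grk x z : (z \in grk x) = (hook (flip x) z == 0).
Proof. by rewrite memv_ker lfunE. Qed.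

Lemma exists_dot_eq1 x : x != 0 -> exists e, dot x e = 1.
Proof.
move=> x0; suff [a [b [c [d abcd]]]] : exists a b c d,
    crd x 0 * a + crd x 1 * b + crd x 2 * c + crd x 3 * d = 1.
  exists (\row_(k < 4) [:: a; b; c; d]`_k).
  by rewrite /dot !crd_row.
have [x00|x00] := eqVneq (crd x 0) 0; last first.
  by exists (crd x 0)^-1, 0, 0, 0; rewrite divff // !mulr0 !addr0.
have [x10|x10] := eqVneq (crd x 1) 0; last first.
  by exists 0, (crd x 1)^-1, 0, 0; rewrite divff // !mulr0 !addr0 add0r.
have [x20|x20] := eqVneq (crd x 2) 0; last first.
  by exists 0, 0, (crd x 2)^-1, 0; rewrite divff // !mulr0 !addr0 !add0r.
have [x30|x30] := eqVneq (crd x 3) 0; last first.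
  by exists 0, 0, 0, (crd x 3)^-1; rewrite divff // !mulr0 !add0r.
by case/eqP: x0; apply: row4P; rewrite crd0.
Qed.

Lemma hook_inj z : (forall e, hook e z = 0) -> z = 0.
Proof.
move=> h.
have h0 := h (\row_(k < 4) [:: 1; 0; 0; 0]`_k).
have h1 := h (\row_(k < 4) [:: 0; 1; 0; 0]`_k).
have h2 := h (\row_(k < 4) [:: 0; 0; 1; 0]`_k).
have c i := (congr1 (fun y => crd y i) h0, congr1 (fun y => crd y i) h1,
             congr1 (fun y => crd y i) h2).
move: (c 1%N) (c 2%N) (c 3%N); rewrite !crd_hook !crd_row //= !crd0.
rewrite !(mul0r, mul1r, subr0, addr0, add0r, oppr0, sub0r).
move=> [[z0 _] _] [[z2 z5] _] [[z4 /eqP]]; rewrite oppr_eq0 => /eqP z3 z1.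
by apply: row6P; rewrite crd0.
Qed.

Lemma exists_hook_eq1 z : z != 0 -> exists e e', dot (hook e z) e' = 1.
Proof.
move=> z0; case: (pickP (fun e => hook e z != 0)) => [e /exists_dot_eq1[e' ee']|].
  by exists e, e'.
move=> h; case/eqP: z0; apply: hook_inj => e.
by have /negbFE/eqP := h e.
Qed.

Lemma plucker_xx x : plucker x x = 0.
Proof. coords. Qed.

Lemma pluckerC x y : plucker x y = - plucker y x.
Proof. coords. Qed.

Lemma plucker_eq0 x y : x != 0 -> (plucker x y == 0) = (y \in <[x]>%VS).
Proof.
move=> x0; apply/eqP/idP => [xy|/vlineP[a ->]]; last first.
  by rewrite linearZ /= plucker_xx scaler0.
have [e xe] := exists_dot_eq1 x0.
have := hook_plucker e x y; rewrite xy linear0 dotC xe scale1r.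
by move/eqP; rewrite eq_sym subr_eq0 => /eqP ->; rewrite memvZ ?memv_line.
Qed.

Lemma lat_plucker x z : x != 0 -> z \in lat x -> exists y, z = plucker x y.
Proof.
move=> /exists_dot_eq1[e xe]; rewrite mem_lat => /eqP xz.
exists (hook e z); rewrite plucker_hook xz xe scale1r [plucker e 0]linear0.
by rewrite (_ : swap 0 = 0) ?subr0 //; coords.
Qed.

Lemma mem_lat_plucker x y : plucker x y \in lat x.
Proof. by rewrite mem_lat wedge_plucker. Qed.

Lemma lat_limg x : x != 0 -> lat x = limg (linfun (plucker x)).
Proof.
move=> x0; apply/vspaceP => z; apply/idP/memv_imgP => [|[y _ ->]].
  by move/(lat_plucker x0) => [y ->]; exists y; rewrite ?memvf ?lfunE.
by rewrite lfunE mem_lat_plucker.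
Qed.

Lemma lker_plucker x : x != 0 -> lker (linfun (plucker x)) = <[x]>%VS.
Proof.
by move=> x0; apply/vspaceP => y; rewrite memv_ker lfunE /= plucker_eq0.
Qed.

Lemma dim_lat x : x != 0 -> \dim (lat x) = 3%N.
Proof.
move=> x0; rewrite lat_limg //.
have := limg_ker_dim (linfun (plucker x)) fullv.
rewrite capfv lker_plucker // dim_vline x0 dimvf /dim /= => -[] //.
Qed.

Lemma lat_singular x z : x != 0 -> z \in lat x -> formK z = 0.
Proof.
by move=> x0 /(lat_plucker x0)[y ->]; rewrite formK_plucker.
Qed.

Lemma flip_eq0 x : (flip x == 0) = (x == 0).
Proof.
have f0 : flip (0 : 'rV[F]_4) = 0 by coords.
by rewrite -[in LHS]f0 (inj_eq (can_inj (@flipK F))).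
Qed.

(** Duality: [swap] carries the Greek plane of [x] to the Latin plane of [flip x], so Greek facts
    reduce to Latin ones. *)
Lemma mem_grk_lat x z : (z \in grk x) = (swap z \in lat (flip x)).
Proof. by rewrite mem_grk mem_lat /wedge swapK. Qed.

Lemma grk_singular x z : x != 0 -> z \in grk x -> formK z = 0.
Proof.
rewrite -flip_eq0 mem_grk_lat => x0 /(lat_singular x0).
by rewrite formK_swap.
Qed.

Lemma flip_linear : linear (@flip F).
Proof. move=> a z z'; coords. Qed.
HB.instance Definition _ :=
  GRing.isLinear.Build F 'rV[F]_4 'rV[F]_4 _ (@flip F) flip_linear.

Lemma swap_linear : linear (@swap F).
Proof. move=> a z z'; coords. Qed.
HB.instance Definition _ :=
  GRing.isLinear.Build F 'rV[F]_6 'rV[F]_6 _ (@swap F) swap_linear.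

Lemma grk_limg x : grk x = (linfun (@swap F) @: lat (flip x))%VS.
Proof.
apply/vspaceP => z; rewrite mem_grk_lat; apply/idP/memv_imgP => [zx|[y yx ->]].
  by exists (swap z); rewrite ?lfunE /= ?swapK.
by rewrite lfunE /= swapK.
Qed.

Lemma dim_grk x : x != 0 -> \dim (grk x) = 3%N.
Proof.
move=> x0; rewrite grk_limg limg_dim_eq ?dim_lat ?flip_eq0 //.
apply/eqP; rewrite -subv0; apply/subvP => z.
rewrite memv_cap memv_ker lfunE /= memv0 => /andP[_ /eqP z0].
by rewrite -[z]swapK z0 linear0.
Qed.

Lemma singular_plucker z : z != 0 -> formK z = 0 -> exists u w, z = plucker u w.
Proof.
move=> /exists_hook_eq1[e [e' ee']] z0.
exists (hook e z), (hook e' z).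
by rewrite plucker_hook2 ee' z0 scale1r scale0r subr0.
Qed.

Lemma span2P u w v :
  reflect (exists a b, v = a *: u + b *: w) (v \in <<[:: u; w]>>%VS).
Proof.
rewrite span_cons span_seq1; apply: (iffP memv_addP).
  by move=> [_ /vlineP[a ->] [_ /vlineP[b ->] ->]]; exists a, b.
by move=> [a [b ->]]; exists (a *: u); rewrite ?memvZ ?memv_line //;
  exists (b *: w); rewrite ?memvZ ?memv_line.
Qed.

Lemma plucker_mem_lat u w v : plucker u w != 0 ->
  (plucker u w \in lat v) = (v \in <<[:: u; w]>>%VS).
Proof.
move=> uw0; rewrite mem_lat; apply/eqP/span2P => [vuw|[a [b ->]]]; last by coords.
have [e [e' ee']] := exists_hook_eq1 uw0.
have := dot_hook_scale e e' v (plucker u w).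
rewrite ee' vuw scale1r !hook_plucker (_ : wedge 0 _ = 0); last by coords.
rewrite subr0 => ->; exists (dot v e * dot e' w - dot v e' * dot e w),
  (dot v e' * dot e u - dot v e * dot e' u).
by coords.
Qed.

(** The contraction of [plucker u w] is a combination of the independent vectors [u] and [w], so it
    vanishes only if both coefficients do. *)
Lemma plucker_mem_grk u w x : plucker u w != 0 ->
  (plucker u w \in grk x) = (bilQ x u == 0) && (bilQ x w == 0).
Proof.
move=> uw0; rewrite mem_grk hook_plucker !bilQ_dot.
apply/eqP/andP => [|[/eqP-> /eqP->]]; last by rewrite !scale0r subr0.
set a := dot _ u; set b := dot _ w => /eqP; rewrite subr_eq0 => /eqP h; split.
  apply/eqP; have := congr1 (plucker u) h; rewrite !linearZ /= plucker_xx scaler0.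
  by move/eqP; rewrite scaler_eq0 (negPf uw0) orbF => /eqP.
apply/eqP; have := congr1 (fun y => plucker y w) h.
rewrite (_ : plucker (a *: w) w = 0); last by coords.
rewrite (_ : plucker (b *: u) w = b *: plucker u w); last by coords.
by move/esym/eqP; rewrite scaler_eq0 (negPf uw0) orbF => /eqP.
Qed.

Lemma dim_span2 u w : plucker u w != 0 -> \dim <<[:: u; w]>> = 2%N.
Proof.
move=> uw0.
have w0 : w != 0 by apply: contra_neq uw0 => ->; coords.
have wu0 : plucker w u != 0.
  by rewrite pluckerC oppr_eq0.
have : free [:: u; w].
  by rewrite free_cons span_seq1 seq1_free w0 -plucker_eq0 // wu0.
by move/eqP.
Qed.

Lemma lines_plucker L : L \in pg_lines F 4 ->
  exists u w, [/\ L = <<[:: u; w]>>%VS, plucker u w != 0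
                & kappa L = <[plucker u w]>%VS].
Proof.
rewrite inE => /eqP dL; have sz : size (vbasis L) = 2%N by rewrite size_tuple.
have := vbasisP L; have kL := @kappaE F L _ _ dL.
case: (tval (vbasis L)) sz => [|u [|w []]] //= _ /andP[/eqP Luw].
rewrite free_cons span_seq1 seq1_free => /andP[uw w0].
exists u, w; split=> //; last exact: kL.
by rewrite pluckerC oppr_eq0 plucker_eq0.
Qed.

Lemma pg_pointsP n (X : {vspace 'rV[F]_n}) :
  reflect (exists2 z, z != 0 & X = <[z]>%VS) (X \in pg_points F n).
Proof.
rewrite inE; apply: (iffP eqP) => [dX|[z z0 ->]]; last by rewrite dim_vline z0.
exists (vpick X); first by rewrite vpick0 -dimv_eq0 dX.
apply/eqP; rewrite eq_sym eqEdim dX dim_vline vpick0 -dimv_eq0 dX /=.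
by rewrite -memvE memv_pick.
Qed.

Definition points_of (U : {vspace 'rV[F]_6}) : {set {vspace 'rV[F]_6}} :=
  [set X in pg_points F 6 | (X <= U)%VS].

(** Turns the set equations behind [is_latin] and [is_greek] into equations between subspaces. *)
Lemma points_of_inj : injective points_of.
Proof.
have sub U W : points_of U = points_of W -> (U <= W)%VS.
  move=> UW; apply/subvP => z zU; have [->|z0] := eqVneq z 0; first exact: mem0v.
  have : <[z]>%VS \in points_of U by rewrite !inE dim_vline z0 -memvE.
  by rewrite UW inE -memvE => /andP[].
move=> U W UW; apply/eqP; rewrite eqEsubv; apply/andP; split; exact: sub.
Qed.

Lemma points_of_kappa (U : {vspace 'rV[F]_6}) :
  (forall z, z \in U -> formK z = 0) ->
  points_of U = [set kappa L | L in [set L in pg_lines F 4 | (kappa L <= U)%VS]].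
Proof.
move=> Using; apply/setP => X; apply/idP/imsetP => [|[L]].
  rewrite inE => /andP[/pg_pointsP[z z0 ->]]; rewrite -memvE => zU.
  have [u [w zuw]] := singular_plucker z0 (Using z zU).
  have uw0 : plucker u w != 0 by rewrite -zuw.
  have kL := kappaE (dim_span2 uw0) erefl.
  exists <<[:: u; w]>>%VS; last by rewrite kL zuw.
  by rewrite !inE dim_span2 //= kL -zuw -memvE.
rewrite inE => /andP[/lines_plucker[u [w [_ uw0 kL]]] kU ->].
by rewrite inE kU kL inE dim_vline uw0.
Qed.

Lemma line_vs_lat x L : L \in pg_lines F 4 ->
  (<[x]> <= L)%VS = (kappa L <= lat x)%VS.
Proof.
move=> /lines_plucker[u [w [-> uw0 ->]]].
by rewrite -!memvE plucker_mem_lat.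
Qed.

Lemma mem_perpQ_line x y : (y \in perpQ <[x]>%VS) = (bilQ x y == 0).
Proof.
rewrite mem_perpQ; apply/forall_inP/eqP => [/(_ x (memv_line x))/eqP //|xy v].
move=> /vlineP[a ->]; have : bilQ (a *: x) y = a * bilQ x y by coords.
by rewrite xy mulr0 => ->.
Qed.

Lemma line_vs_grk x L : L \in pg_lines F 4 ->
  (L <= perpQ <[x]>)%VS = (kappa L <= grk x)%VS.
Proof.
move=> /lines_plucker[u [w [-> uw0 ->]]].
rewrite -memvE plucker_mem_grk // span_cons span_seq1 subv_add -!memvE.
by rewrite !mem_perpQ_line.
Qed.

Lemma is_latinE x (pi : Omega F 3) : x != 0 ->
  is_latin <[x]>%VS pi = (val pi == lat x).
Proof.
move=> x0; rewrite -(inj_eq points_of_inj) (@points_of_kappa (lat x)); last first.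
  by move=> z; apply: lat_singular.
suff -> : [set L in pg_lines F 4 | (kappa L <= lat x)%VS]
  = lines_through <[x]> by [].
by apply/setP => L; rewrite !inE; case: eqP => //= dL; rewrite line_vs_lat ?inE ?dL.
Qed.

Lemma is_greekE x (pi : Omega F 3) : x != 0 ->
  is_greek <[x]>%VS pi = (val pi == grk x).
Proof.
move=> x0; rewrite -(inj_eq points_of_inj) (@points_of_kappa (grk x)); last first.
  by move=> z; apply: grk_singular.
suff -> : [set L in pg_lines F 4 | (kappa L <= grk x)%VS]
  = lines_inside (perpQ <[x]>) by [].
by apply/setP => L; rewrite !inE; case: eqP => //= dL; rewrite line_vs_grk ?inE ?dL.
Qed.

Lemma latP x : x != 0 ->
  (\dim (lat x) == 3%N) && totally_singular (@formK F) (lat x).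
Proof.
move=> x0; rewrite dim_lat //=; apply/forall_inP => z zx.
by rewrite (lat_singular x0).
Qed.

Lemma grkP x : x != 0 ->
  (\dim (grk x) == 3%N) && totally_singular (@formK F) (grk x).
Proof.
move=> x0; rewrite dim_grk //=; apply/forall_inP => z zx.
by rewrite (grk_singular x0).
Qed.

Lemma lat_cap_line x v : v \in <[x]>%VS -> (lat x <= lat v)%VS.
Proof.
move=> /vlineP[a ->]; apply/subvP => z; rewrite !mem_lat => /eqP xz.
have -> : wedge (a *: x) z = a *: wedge x z by coords.
by rewrite xz scaler0.
Qed.

Lemma lat0 : lat 0 = fullv.
Proof.
by apply/vspaceP => z; rewrite memvf mem_lat (_ : wedge _ _ = 0) ?eqxx //; coords.
Qed.

(** Two distinct points are joined by a single line. *)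
Lemma lat_cap x v : x != 0 -> v \notin <[x]>%VS ->
  (lat x :&: lat v = <[plucker x v]>)%VS.
Proof.
move=> x0 vx; apply/vspaceP => z; rewrite memv_cap.
apply/andP/vlineP => [[/(lat_plucker x0)[y zxy]]|[a ->]]; last first.
  split; first by rewrite memvZ ?mem_lat_plucker.
  rewrite mem_lat linearZ /= (_ : wedge _ _ = 0) ?scaler0 //; coords.
have [->|z0] := eqVneq z 0; first by exists 0; rewrite scale0r.
rewrite zxy plucker_mem_lat -?zxy // => /span2P[a [b vab]].
have [b0|b0] := eqVneq b 0.
  by case/negP: vx; rewrite vab b0 scale0r addr0 memvZ ?memv_line.
exists b^-1; rewrite vab linearD !linearZ /= plucker_xx scaler0 add0r.
by rewrite scalerA mulVf ?scale1r.
Qed.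

Lemma dim_lat_cap x v : x != 0 ->
  \dim (lat x :&: lat v) = if v \in <[x]>%VS then 3%N else 1%N.
Proof.
move=> x0; case: ifPn => vx; first by rewrite (capv_idPl (lat_cap_line vx)) dim_lat.
by rewrite lat_cap // dim_vline plucker_eq0 // vx.
Qed.

Definition orth x : {vspace 'rV[F]_4} := lker (linfun (bilQ x : 'rV[F]_4 -> F^o)).

Lemma mem_orth x y : (y \in orth x) = (bilQ x y == 0).
Proof. by rewrite memv_ker lfunE. Qed.

Lemma dim_orth x : x != 0 -> \dim (orth x) = 3%N.
Proof.
move=> x0; set f := linfun (bilQ x : 'rV[F]_4 -> F^o).
have := limg_ker_dim f fullv.
rewrite capfv -/(orth x) dimvf /dim /= => h.
have: (\dim (limg f) <= 1)%N by rewrite (leq_trans (dimvS (subvf _))) ?dimvf.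
have: (0 < \dim (limg f))%N.
  rewrite lt0n dimv_eq0; apply/eqP => f0.
  have [e] : exists e, dot (flip x) e = 1 by apply: exists_dot_eq1; rewrite flip_eq0.
  rewrite -bilQ_dot => xe.
  have : f e \in limg f by rewrite memv_img ?memvf.
  by rewrite f0 memv0 lfunE /= xe oner_eq0.
by move: h; case: (\dim (limg f)) => [|[|]] // + _ _; rewrite addn1 => -[].
Qed.

(** The lines through [v] in the polar plane of [x] form a pencil if [v] is in that plane; otherwise
    there are none. *)
Lemma dim_grk_cap x v : x != 0 -> v != 0 ->
  \dim (grk x :&: lat v) = if bilQ x v == 0 then 2%N else 0%N.
Proof.
move=> x0 v0.
have hk y : plucker v y \in grk x = (bilQ x v *: y == bilQ x y *: v).
  by rewrite mem_grk hook_plucker -!bilQ_dot subr_eq0.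
case: eqP => xv; last first.
  apply/eqP; rewrite dimv_eq0 -subv0; apply/subvP => z; rewrite memv_cap memv0.
  case/andP => zx /(lat_plucker v0)[y zvy]; rewrite zvy plucker_eq0 //.
  move: zx; rewrite zvy hk => /eqP h; apply/vlineP.
  exists ((bilQ x v)^-1 * bilQ x y).
  by rewrite -scalerA -h scalerA mulVf ?scale1r //; apply/eqP.
(* The pencil is the image of [orth x] under [plucker v], whose kernel is [<[v]>]: dimension 3 -
   1. *)
have -> : (grk x :&: lat v = linfun (plucker v) @: orth x)%VS.
  apply/vspaceP => z; rewrite memv_cap; apply/andP/memv_imgP.
    case=> zx /(lat_plucker v0)[y zvy]; exists y; rewrite ?lfunE //.
    move: zx; rewrite zvy hk mem_orth xv scale0r eq_sym scaler_eq0.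
    by rewrite (negPf v0) orbF.
  case=> y; rewrite mem_orth lfunE /= => /eqP xy ->.
  by rewrite mem_lat_plucker hk xv xy !scale0r.
have := limg_ker_dim (linfun (plucker v)) (orth x).
rewrite lker_plucker // dim_orth // (capv_idPr _); last first.
  by rewrite -memvE mem_orth xv.
by rewrite dim_vline v0 => -[].
Qed.

Lemma lat_eq x y : x != 0 -> y != 0 -> (lat x == lat y) = (<[x]>%VS == <[y]>%VS).
Proof.
move=> x0 y0; apply/eqP/eqP => [xy|xy]; last first.
  apply/eqP; rewrite eqEsubv !lat_cap_line //.
    by rewrite -xy memv_line.
  by rewrite xy memv_line.
have := dim_lat_cap y x0; rewrite xy capvv dim_lat //; case: ifP => // yx _.
by apply/eqP; rewrite eq_sym eqEdim -memvE yx !dim_vline x0 y0.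
Qed.

Lemma grk_eq x y : x != 0 -> y != 0 -> (grk x == grk y) = (<[x]>%VS == <[y]>%VS).
Proof.
move=> x0 y0.
have flip_line a : <[flip a]>%VS = (linfun (@flip F) @: <[a]>)%VS.
  by rewrite limg_line lfunE.
have -> : (grk x == grk y) = (lat (flip x) == lat (flip y)).
  apply/eqP/eqP => /vspaceP h; apply/vspaceP => z.
    by have := h (swap z); rewrite (mem_grk_lat x) (mem_grk_lat y) swapK.
  by rewrite (mem_grk_lat x) (mem_grk_lat y) h.
rewrite lat_eq ?flip_eq0 //; apply/eqP/eqP => [|xy]; last by rewrite !flip_line xy.
move=> /(congr1 (fun U => linfun (@flip F) @: U)%VS).
by rewrite -!flip_line !flipK.
Qed.

(** A common plane would meet itself in dimension 3, but a Latin and a Greek plane meet in dimension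
    0 or 2. *)
Lemma lat_neq_grk x y : x != 0 -> y != 0 -> lat x != grk y.
Proof.
move=> x0 y0; apply/eqP => xy; have := dim_grk_cap y0 x0.
by rewrite -xy capvv dim_lat //; case: ifP.
Qed.

End Geometry.

(** * Classification of the planes of the Klein quadric *)

Section Classification.
Variable F : finFieldType.
Implicit Types (u v w x y e : 'rV[F]_4) (z : 'rV[F]_6).

Lemma card_line_lat z : z != 0 -> formK z = 0 ->
  #|[set a | z \in lat a]| = (#|F| ^ 2)%N.
Proof.
move=> z0 /(singular_plucker z0)[u [w zuw]]; rewrite zuw in z0 *.
have := card_vspace <<[:: u; w]>>; rewrite dim_span2 // => <-.
by apply: eq_card => a; rewrite inE plucker_mem_lat.
Qed.

Lemma card_nonzero n (W : {vspace 'rV[F]_n}) :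
  (#|[pred z in W | z != 0%R]| = #|F| ^ \dim W - 1)%N.
Proof.
rewrite -card_vspace (cardD1 (0 : 'rV[F]_n) W) mem0v addKn.
by apply: eq_card => z; rewrite !inE andbC.
Qed.

(* Pigeonhole: if [U :&: lat a] had dimension at most 1 for all [a != 0], there would
   be too few pairs [(a, z)] with [z] in [U] and [a] on the line of [z]. *)
Lemma exists_dim_cap_lat (U : {vspace 'rV[F]_6}) :
  \dim U = 3%N -> (forall z, z \in U -> formK z = 0) ->
  exists2 a, a != 0%R & (1 < \dim (U :&: lat a))%N.
Proof.
move=> dU Using.
case: (pickP [pred a | (a != 0) && (1 < \dim (U :&: lat a))%N]) => [a|no].
  by move=> /= /andP[a0 da]; exists a.
have q1 : (1 < #|F|)%N by apply: finNzRing_gt1.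
(* The term [a = 0] contributes all of [U], every other [a] at most [q] vectors. *)
have count_a : (\sum_(a : 'rV[F]_4) #|(U :&: lat a)%VS|
    <= #|F| ^ 3 + (#|F| ^ 4 - 1) * #|F|)%N.
  rewrite (bigD1 0) //= lat0 capvf card_vspace dU leq_add2l.
  have -> : (#|F| ^ 4 - 1 = #|[pred a : 'rV[F]_4 | a != 0%R]|)%N.
    have := cardC1 (0 : 'rV[F]_4); rewrite card_mx mul1n subn1 => <-.
    by apply: eq_card.
  rewrite -sum_nat_const leq_sum // => a a0; rewrite card_vspace.
  rewrite -[leqRHS]expn1 leq_exp2l // leqNgt.
  by have := no a; rewrite /= a0 /= => ->.
(* Counted by [z]: the zero vector lies in every [lat a], and a nonzero [z] is a line with [q ^ 2]
   vectors. *)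
have count_z : (\sum_(a : 'rV[F]_4) #|(U :&: lat a)%VS|
    = #|F| ^ 4 + (#|F| ^ 3 - 1) * #|F| ^ 2)%N.
  transitivity (\sum_(a : 'rV[F]_4) \sum_(z in U) (z \in lat a))%N.
    apply: eq_bigr => a _; rewrite -sum1_card big_mkcond [RHS]big_mkcond /=.
    by apply: eq_bigr => z _; rewrite memv_cap; case: (z \in U); case: (z \in lat a).
  rewrite exchange_big (bigD1 0) ?mem0v //=; congr addn.
    under eq_bigr => a _ do rewrite mem0v.
    by rewrite sum1_card card_mx.
  have := card_nonzero U; rewrite dU => <-.
  rewrite -sum_nat_const; apply: eq_bigr => z /andP[zU z0].
  rewrite -(card_line_lat z0 (Using z zU)) -sum1_card [RHS]big_mkcond /=.
  by apply: eq_bigr => a _; rewrite inE; case: (z \in lat a).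
(* The exact count exceeds the bound by [q (q - 1) (q ^ 2 - 1)]. *)
exfalso; move: count_a; rewrite count_z.
move: q1; case: #|F| => [|[|p]] // _; rewrite !expnS expn0; nia.
Qed.

(** Some point [a] lies on all lines of a part of [U] of dimension at least 2. Either it lies on all
    lines of [U], the Latin case, or a line [z3] of [U] avoiding [a] spans with it the plane of the
    Greek case. *)
Lemma lat_or_grk (pi : Omega F 3) : exists2 x, x != 0 &
  val pi = lat x \/ val pi = grk x.
Proof.
case: pi => U /= /andP[/eqP dU /forall_inP Using].
have {}Using z : z \in U -> formK z = 0 by move=> /Using/eqP.
have [a a0 da] := exists_dim_cap_lat dU Using.
have [Ua|] := boolP (U <= lat a)%VS.
  by exists a => //; left; apply/eqP; rewrite eqEdim Ua dim_lat ?dU.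
case/subvPn => z3 z3U; rewrite mem_lat => xi0.
exists (flip (wedge a z3)); first by rewrite flip_eq0.
(* The lines of [U] through [a] meet the line [z3], which misses [a]; hence they lie in
   the plane spanned by [a] and [z3], whose equation is [wedge a z3]. *)
right; apply/eqP.
rewrite eqEdim dU dim_grk ?flip_eq0 // leqnn andbT.
have -> : U = (U :&: lat a + <[z3]>)%VS.
  apply/eqP; rewrite eq_sym eqEdim subv_add capvSl -memvE z3U /= dU.
  rewrite dimv_disjoint_sum; last first.
    apply/eqP; rewrite -subv0; apply/subvP => z; rewrite memv_cap memv_cap memv0.
    move=> /andP[/andP[_ za] /vlineP[c zc]]; move: za.
    rewrite zc mem_lat linearZ /= scaler_eq0 (negPf xi0) orbF => /eqP ->.
    by rewrite scale0r.
  rewrite dim_vline (_ : z3 != 0) ?addn1 //.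
  by apply: contra_neq xi0 => ->; rewrite linear0.
rewrite subv_add -memvE mem_grk flipK hook_wedge Using // oppr0 scale0r eqxx andbT.
apply/subvP => z; rewrite memv_cap => /andP[zU /(lat_plucker a0)[b zab]].
(* By [dot_wedge] both coefficients are polarizations of [formK] at vectors of [U], where [formK]
   vanishes. *)
rewrite mem_grk flipK zab hook_plucker !dot_wedge plucker_xx addr0 -zab.
by rewrite !Using ?memvD ?mem0v // !subrr !scale0r subrr.
Qed.

(** Each nonzero vector of [U] lies in exactly one point, and each point has [q - 1] of them. *)
Lemma card_points_of (U : {vspace 'rV[F]_6}) : totally_singular (@formK F) U ->
  ((#|F| - 1) * #|[set X : Omega F 1 | val X <= U]%VS| = #|F| ^ \dim U - 1)%N.
Proof.
move=> /forall_inP Using.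
rewrite -card_nonzero -[RHS]sum1_card mulnC -sum_nat_const.
transitivity (\sum_(X : Omega F 1 | (val X <= U)%VS)
                \sum_(z in U | z != 0%R) (z \in val X))%N.
  apply: eq_big => [X|X]; first by rewrite inE.
  rewrite inE => XU; have /andP[/eqP dX _] := valP X.
  have := card_nonzero (val X); rewrite dX expn1 => <-.
  rewrite -sum1_card big_mkcond [RHS]big_mkcond /=.
  apply: eq_bigr => z _; rewrite !inE; case: eqP => _; rewrite ?andbT ?andbF //.
  have [zX|_] := boolP (z \in val X); last by case: ifP.
  by rewrite (subvP XU z zX).
rewrite exchange_big /=; apply: eq_bigr => z /andP[zU z0].
have Xz : (\dim <[z]> == 1%N) && totally_singular (@formK F) <[z]>.
  rewrite dim_vline z0; apply/forall_inP => _ /vlineP[a ->].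
  by apply: Using; rewrite memvZ.
rewrite (bigD1 (Sub <[z]>%VS Xz : Omega F 1)) /=; last by rewrite -memvE.
rewrite memv_line big1 // => X /andP[XU]; case: (boolP (z \in _)) => // zX.
case/eqP; apply/val_inj/eqP; rewrite eq_sym eqEdim -memvE zX /= dim_vline z0.
by have /andP[/eqP-> _] := valP X.
Qed.

End Classification.

(** * Sums of functions of the quadratic form *)

Section Sums.
Variables (F : finFieldType) (R : comNzRingType) (phi : F -> R).
Implicit Types (v x y : 'rV[F]_4).
Let q : R := #|F|%:R.
Let Phi : R := \sum_t phi t.

Definition row4 (a b c d : F) : 'rV[F]_4 := \row_(k < 4) [:: a; b; c; d]`_k.

Lemma crd_row4 a b c d : (crd (row4 a b c d) 0 = a) * (crd (row4 a b c d) 1 = b) *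
  (crd (row4 a b c d) 2 = c) * (crd (row4 a b c d) 3 = d).
Proof. by rewrite !crd_row. Qed.

Lemma row4E v : row4 (crd v 0) (crd v 1) (crd v 2) (crd v 3) = v.
Proof. by apply: row4P; rewrite crd_row4. Qed.

Lemma sum_nonzero (g : F -> R) s : (forall t, t != 0 -> g t = s) ->
  \sum_t g t = g 0 + (q - 1) * s.
Proof.
move=> gs; rewrite (bigD1 0) //= (eq_bigr (fun=> s)) // sumr_const; congr (_ + _).
rewrite cardC1 /q; have := ltnW (finNzRing_gt1 F); case: #|F| => // p _.
by rewrite -natr1 addrK mulr_natl.
Qed.

Lemma sum_const (c : R) : \sum_(t : F) c = q * c.
Proof. by rewrite sumr_const mulr_natl. Qed.

(** For [m != 0] the map [n ↦ m n + s] permutes [F]; [m = 0] contributes [q] times [phi s]. *)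
Lemma sum_hyperbolic s :
  \sum_m \sum_n phi (m * n + s) = (q - 1) * Phi + q * phi s.
Proof.
rewrite (@sum_nonzero _ Phi) => [|m m0].
  under eq_bigr => n _ do rewrite mul0r add0r.
  by rewrite sum_const addrC.
rewrite [RHS](reindex (fun n => m * n + s)) //.
exists (fun t => m^-1 * (t - s)) => t _; first by rewrite addrK mulKf.
by rewrite mulVKf ?subrK.
Qed.

Lemma sum_rV4 (g : 'rV[F]_4 -> R) :
  \sum_v g v = \sum_a \sum_b \sum_c \sum_d g (row4 a b c d).
Proof.
pose h (t : F * F * F * F) := row4 t.1.1.1 t.1.1.2 t.1.2 t.2.
rewrite (reindex h) /=; last first.
  exists (fun v => (crd v 0, crd v 1, crd v 2, crd v 3)).
    by move=> [[[a b] c] d] _; rewrite /h /= !crd_row4.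
  by move=> v _; rewrite /h /= row4E.
rewrite (eq_bigr (fun t : F * F * F * F => g (row4 t.1.1.1 t.1.1.2 t.1.2 t.2))) //.
rewrite -(pair_bigA _ (fun (t : F * F * F) d => g (row4 t.1.1 t.1.2 t.2 d))) /=.
rewrite -(pair_bigA _ (fun (t : F * F) c => \sum_d g (row4 t.1 t.2 c d))) /=.
by rewrite -(pair_bigA _ (fun a b => \sum_c \sum_d g (row4 a b c d))).
Qed.

(** Two uses of [sum_hyperbolic]: on the last two coordinates, shifted by the product of the first
    two, then on the first two with shift 0. *)
Lemma sum_formQ :
  \sum_v phi (formQ v) = q * (q ^+ 2 - 1) * Phi + q ^+ 2 * phi 0.
Proof.
rewrite sum_rV4.
under eq_bigr => a _ do under eq_bigr => b _ do
  under eq_bigr => c _ do under eq_bigr => d _ do rewrite /formQ !crd_row4 addrC.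
under eq_bigr => a _ do under eq_bigr => b _ do rewrite sum_hyperbolic.
under eq_bigr => a _ do rewrite big_split /= sum_const -mulr_sumr.
rewrite big_split /= sum_const -mulr_sumr.
have := sum_hyperbolic 0.
under eq_bigr => a _ do under eq_bigr => b _ do rewrite addr0.
by move=> ->; ring.
Qed.

Hypothesis phi_sqr : forall c t, c != 0 -> phi (c ^+ 2 * t) = phi t.

Lemma sum_line x : x != 0 ->
  \sum_(v in <[x]>%VS) phi (formQ v) = phi 0 + (q - 1) * phi (formQ x).
Proof.
move=> x0; have Qs a : formQ (a *: x) = a ^+ 2 * formQ x by coords.
have [e xe] := exists_dot_eq1 x0.
(* The form [e] recovers the scalar [a] from [a *: x]. *)
rewrite (reindex_onto (fun a => a *: x) (fun v => dot v e)) /=.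
  rewrite (eq_bigl xpredT) => [|a]; last first.
    rewrite memvZ ?memv_line //= (_ : dot (a *: x) e = a * dot x e); last by coords.
    by rewrite xe mulr1 eqxx.
  rewrite (@sum_nonzero _ (phi (formQ x))) => [|a a0]; last by rewrite Qs phi_sqr.
  by rewrite Qs expr0n mul0r.
move=> _ /vlineP[a ->].
rewrite (_ : dot (a *: x) e = a * dot x e); last by coords.
by rewrite xe mulr1.
Qed.

(** Kept as a predicate so that isometries of [formQ] can transport it between vectors. *)
Definition sum_orth_spec x :=
  \sum_(v | bilQ x v == 0) phi (formQ v) =
    q * (q - 1) * Phi + q * (phi 0 + (q - 1) * phi (- formQ x)).

Lemma sum_orth_isometry (g : 'rV[F]_4 -> 'rV[F]_4) x : involutive g ->
  (forall v, formQ (g v) = formQ v) -> (forall y v, bilQ (g y) (g v) = bilQ y v) ->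
  sum_orth_spec (g x) -> sum_orth_spec x.
Proof.
move=> gK gQ gB; rewrite /sum_orth_spec gQ => <-.
rewrite [RHS](reindex_inj (can_inj gK)) /=.
by apply: eq_big => v; rewrite ?gB ?gQ.
Qed.

(* The vectors of [x^⊥] are parametrized by [(a, m, n)] with
   [v_1 = x_1 a], [v_2 = m + x_2 a], [v_3 = n + x_3 a]; then
   [formQ v = m n - formQ x * a ^ 2]. *)
Lemma sum_orth_crd1 x : crd x 1 != 0 -> sum_orth_spec x.
Proof.
move=> x1; rewrite /sum_orth_spec.
pose h (t : F * F * F) := let a := t.1.1 in let m := t.1.2 in let n := t.2 in
  row4 (- (crd x 0 * a + (crd x 2 * n + crd x 3 * m
            + crd x 2 * crd x 3 *+ 2 * a) / crd x 1))
       (crd x 1 * a) (m + crd x 2 * a) (n + crd x 3 * a).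
pose k v := (crd v 1 / crd x 1, crd v 2 - crd x 2 * (crd v 1 / crd x 1),
             crd v 3 - crd x 3 * (crd v 1 / crd x 1)).
have hk v : bilQ x v == 0 -> h (k v) = v.
  rewrite (_ : bilQ x v = crd x 0 * crd v 1 + crd x 1 * crd v 0 + crd x 2 * crd v 3
    + crd x 3 * crd v 2); last by coords.
  move=> /eqP xv; apply: row4P; rewrite crd_row4 /=.
  - have -> : crd v 0 = - (crd x 0 * crd v 1 + crd x 2 * crd v 3
      + crd x 3 * crd v 2) / crd x 1.
      apply: (mulIf x1); rewrite mulfVK // mulrC.
      by apply/eqP; rewrite -subr_eq0 -xv; apply/eqP; ring.
    by field.
  - by field.
  - by ring.
  - by ring.
have Bh t : bilQ x (h t) = 0.
  rewrite (_ : bilQ x (h t) = crd x 0 * crd (h t) 1 + crd x 1 * crd (h t) 0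
    + crd x 2 * crd (h t) 3 + crd x 3 * crd (h t) 2); last by coords.
  by rewrite !crd_row4; field.
have Qh t : formQ (h t) = t.1.2 * t.2 + - formQ x * t.1.1 ^+ 2.
  by rewrite /formQ !crd_row4; field.
rewrite (reindex_onto h k) //=.
rewrite (eq_bigl xpredT) => [|[[a m] n]]; last first.
  rewrite Bh eqxx /= /k /h !crd_row4 /= mulrAC divff // mul1r !addrK.
  by rewrite !eqxx.
rewrite (eq_bigr (fun t : F * F * F => phi (t.1.2 * t.2 + - formQ x * t.1.1 ^+ 2)));
  last by move=> t _; rewrite Qh.
rewrite -(pair_bigA _ (fun (t : F * F) n => phi (t.2 * n + - formQ x * t.1 ^+ 2))) /=.
rewrite -(pair_bigA _ (fun a m => \sum_n phi (m * n + - formQ x * a ^+ 2))) /=.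
under eq_bigr => a _ do rewrite sum_hyperbolic.
rewrite big_split /= sum_const -mulr_sumr.
rewrite (@sum_nonzero _ (phi (- formQ x))) => [|a a0].
  by rewrite expr0n mulr0; ring.
by rewrite mulrC phi_sqr.
Qed.

Lemma sum_orth x : x != 0 -> sum_orth_spec x.
Proof.
(* Isometries permuting the coordinates; together they bring any nonzero coordinate of [x] to
   position 1. *)
pose s01 x := row4 (crd x 1) (crd x 0) (crd x 2) (crd x 3).
pose s02 x := row4 (crd x 2) (crd x 3) (crd x 0) (crd x 1).
have use01 y : sum_orth_spec (s01 y) -> sum_orth_spec y.
  apply: sum_orth_isometry => [v|v|z v].
  - by apply: row4P; rewrite !crd_row4.
  - by rewrite /formQ !crd_row4; ring.
  - by rewrite /bilQ /formQ !crdD !crd_row4; ring.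
have use02 y : sum_orth_spec (s02 y) -> sum_orth_spec y.
  apply: sum_orth_isometry => [v|v|z v].
  - by apply: row4P; rewrite !crd_row4.
  - by rewrite /formQ !crd_row4; ring.
  - by rewrite /bilQ /formQ !crdD !crd_row4; ring.
move=> x0.
have [x1|x1] := eqVneq (crd x 1) 0; last exact: sum_orth_crd1.
have [x00|x00] := eqVneq (crd x 0) 0; last first.
  by apply: use01; apply: sum_orth_crd1; rewrite crd_row4.
have [x3|x3] := eqVneq (crd x 3) 0; last first.
  by apply: use02; apply: sum_orth_crd1; rewrite crd_row4.
have [x2|x2] := eqVneq (crd x 2) 0; last first.
  by apply: use02; apply: use01; apply: sum_orth_crd1; rewrite !crd_row4.
by case/eqP: x0; apply: row4P; rewrite crd0.
Qed.

End Sums.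

(** * The image of the incidence map *)

Section Weights.
Variables (F : finFieldType) (R : realType).
Implicit Types (v x y : 'rV[F]_4) (pi : Omega F 3) (phi : F -> R).
Local Notation q := (#|F|%:R : R).

Lemma q_gt1 : 1 < q.
Proof. by rewrite ltr1n finNzRing_gt1. Qed.

(** Makes [phi (formQ x)] depend only on the point [<[x]>], as scaling [x] by [c] multiplies
    [formQ x] by [c ^ 2]. *)
Definition square_invariant (T : Type) (phi : F -> T) :=
  forall c t, c != 0 -> phi (c ^+ 2 * t) = phi t.

(* If [X = kappa L], then [X <= lat v] says that [v] lies on [L]. *)
Definition weight phi : {ffun Omega F 1 -> R^o} :=
  [ffun X => \sum_(v | (val X <= lat v)%VS) phi (formQ v)].

(** After exchanging sums, [v] counts once for each point of [val pi :&: lat v]; the factor [q - 1]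
    clears the denominator of that number. *)
Lemma incidence_weight phi pi :
  (q - 1) * incidence (weight phi) pi =
    \sum_v (q ^+ \dim (val pi :&: lat v) - 1) * phi (formQ v).
Proof.
have q0 : (0 < #|F|)%N by apply: ltnW (finNzRing_gt1 F).
rewrite /incidence ffunE.
transitivity ((q - 1) * \sum_v
    #|[set X : Omega F 1 | val X <= val pi :&: lat v]%VS|%:R * phi (formQ v)).
  congr (_ * _); under eq_bigr => X _ do rewrite ffunE mulr_sumr big_mkcond.
  rewrite exchange_big /=; apply: eq_bigr => v _.
  rewrite -sum1_card natr_sum mulr_suml [RHS]big_mkcond /=.
  apply: eq_bigr => X _; rewrite inE subv_cap.
  by case: (_ <= lat v)%VS; case: (_ <= val pi)%VS; rewrite ?mul0r.
rewrite mulr_sumr; apply: eq_bigr => v _; rewrite mulrA; congr (_ * _).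
have /andP[_ /forall_inP pising] := valP pi.
have /card_points_of/(congr1 (fun n => n%:R : R)) :
    totally_singular (@formK F) (val pi :&: lat v).
  by apply/forall_inP => z; rewrite memv_cap => /andP[/pising].
by rewrite natrM !natrB ?expn_gt0 ?q0 // natrX.
Qed.

Definition weight_cst phi : R :=
  q * (q - 1) * (q ^+ 2 - 1) * (\sum_t phi t)
  + (q ^+ 2 * (q - 1) + q * (q ^+ 2 - 1)) * phi 0.

Lemma incidence_weight_lat phi pi x : square_invariant phi ->
  x != 0 -> val pi = lat x ->
  (q - 1) * incidence (weight phi) pi =
    weight_cst phi + (q - 1) * q * (q ^+ 2 - 1) * phi (formQ x).
Proof.
move=> phi_sqr x0 pix; rewrite incidence_weight pix.
(* The intersection has dimension 3 for [v] on [<[x]>] and 1 elsewhere. *)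
transitivity (\sum_v ((q - 1) * phi (formQ v) +
    (q ^+ 3 - q) * (if v \in <[x]>%VS then phi (formQ v) else 0))).
  by apply: eq_bigr => v _; rewrite dim_lat_cap //; case: ifP => _; ring.
rewrite big_split /= -!mulr_sumr -big_mkcond /= sum_formQ sum_line //.
by rewrite /weight_cst; ring.
Qed.

Lemma incidence_weight_grk phi pi x : square_invariant phi ->
  x != 0 -> val pi = grk x ->
  (q - 1) * incidence (weight phi) pi =
    weight_cst phi + (q - 1) * q * (q ^+ 2 - 1) * phi (- formQ x).
Proof.
move=> phi_sqr x0 pix; rewrite incidence_weight pix.
(* Dimension 2 on the polar plane, 0 off it; the last term corrects [v = 0], where [lat 0] is the
   whole space and the dimension is 3. *)
transitivity (\sum_v ((q ^+ 2 - 1) * (if bilQ x v == 0 then phi (formQ v) else 0)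
    + (if v == 0 then (q ^+ 3 - q ^+ 2) * phi 0 else 0))).
  apply: eq_bigr => v _; have [->|v0] := eqVneq v 0.
    rewrite lat0 capvf dim_grk // linear0 eqxx.
    by rewrite (_ : formQ 0 = 0); [ring | coords].
  by rewrite dim_grk_cap // addr0; case: ifP => _; ring.
rewrite big_split /= -!mulr_sumr -!big_mkcond /= big_pred1_eq.
by rewrite (sum_orth phi_sqr x0) /weight_cst; ring.
Qed.

Lemma incidence_exists phi : square_invariant phi ->
  exists f : {ffun Omega F 1 -> R^o}, forall pi x, x != 0 ->
    (val pi = lat x -> incidence f pi = phi (formQ x)) /\
    (val pi = grk x -> incidence f pi = phi (- formQ x)).
Proof.
move=> phi_sqr; have q1 := q_gt1.
have one_sqr : square_invariant (fun _ : F => 1 : R) by [].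
(* [D] is the coefficient of [phi]; [N] is [q - 1] times the constant image of the weight of 1, a
   multiple of which cancels [weight_cst phi]. *)
pose D := (q - 1) * q * (q ^+ 2 - 1).
pose N := weight_cst (fun=> 1) + D.
have D0 : 0 < D.
  by rewrite /D !mulr_gt0 //; nra.
have N0 : 0 < N.
  rewrite addr_gt0 // /weight_cst sum_const; nra.
pose K := weight_cst phi.
exists ((q - 1) / D *: weight phi + (- (K * (q - 1) / (D * N))) *: weight (fun=> 1)).
have solve I J t : (q - 1) * I = K + D * t -> (q - 1) * J = N ->
    (q - 1) / D * I + - (K * (q - 1) / (D * N)) * J = t.
  move=> hI hJ; have -> : t = ((q - 1) * I - K) / D.
    by rewrite hI; field; lra.
  rewrite -hJ; field.
  by rewrite -hJ in N0; nra.
have comb (g h : {ffun Omega F 3 -> R^o}) a b pi :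
    (a *: g + b *: h) pi = a * g pi + b * h pi by rewrite !ffunE.
move=> pi x x0; rewrite linearD !linearZ /= comb; split=> pix; apply: solve.
- by rewrite (incidence_weight_lat phi_sqr x0 pix).
- by rewrite (incidence_weight_lat one_sqr x0 pix) mulr1.
- by rewrite (incidence_weight_grk phi_sqr x0 pix).
- by rewrite (incidence_weight_grk one_sqr x0 pix) mulr1.
Qed.

Lemma card_omega3 : (0 < #|Omega F 3|)%N.
Proof.
pose x : 'rV[F]_4 := row4 1 0 0 0.
have x0 : x != 0.
  apply/eqP => /(congr1 (fun y => crd y 0)); rewrite crd_row4 crd0.
  by apply/eqP; apply: oner_neq0.
by apply/card_gt0P; exists (Sub (lat x) (latP x0)).
Qed.

(** The all-ones vector lies in the image, so subtracting the orthogonal projection onto it leaves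
    an element of [V1]. *)
Lemma limg_degree_one (L : {set Omega F 3}) :
  charvec R L \in limg (linfun (@incidence F R)) -> degree_one_CL R L.
Proof.
move=> Lim; have [f f1] := @incidence_exists (fun=> 1) (fun _ _ _ => erefl).
have jim : allones F R \in limg (linfun (@incidence F R)).
  apply/memv_imgP; exists f; rewrite ?memvf // lfunE /=; apply/ffunP => pi.
  rewrite [LHS]ffunE; have [x x0 pix] := lat_or_grk pi.
  by have [fl fg] := f1 pi x x0; case: pix => [/fl|/fg] ->.
have jj : dotj (allones F R) != 0.
  rewrite /dotj (eq_bigr (fun=> 1)) => [|pi _]; last by rewrite !ffunE mulr1.
  by rewrite sumr_const pnatr_eq0 -lt0n card_omega3.
rewrite /degree_one_CL.
pose a := dotj (charvec R L) / dotj (allones F R).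
rewrite -[charvec R L](subrK (a *: allones F R)) addrC memv_add //.
  by rewrite memvZ ?memv_line.
rewrite memv_cap memv_ker lfunE memvB ?memvZ //=.
by rewrite linearB linearZ /= -[_ *: _]/(_ * _) mulfVK ?subrr.
Qed.

(** * Counting the planes of a family *)

Section Core.
Variable alpha : F -> bool.
Let phi t : R := (alpha t)%:R.

(** This is [sum_formQ] for the indicator function of [alpha], with the zero vector removed. *)
Lemma card_vectors :
  #|[set x : 'rV[F]_4 | (x != 0) && alpha (formQ x)]|%:R =
    (q ^+ 2 - 1) * (q * #|[set t | alpha t]|%:R + (alpha 0)%:R).
Proof.
have -> : #|[set t | alpha t]|%:R = \sum_t phi t.
  rewrite -sum1_card natr_sum big_mkcond /=; apply: eq_bigr => t _.
  by rewrite inE /phi; case: (alpha t).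
have := sum_formQ phi; rewrite (bigD1 0) //= (_ : formQ 0 = 0); last by coords.
have -> : #|[set x : 'rV[F]_4 | (x != 0) && alpha (formQ x)]|%:R =
    \sum_(x | x != 0) phi (formQ x).
  rewrite -sum1_card natr_sum big_mkcond [RHS]big_mkcond /=; apply: eq_bigr => x _.
  by rewrite inE /phi; case: (x != 0) => //=; case: alpha.
by move=> sumQ; apply: (addrI (phi 0)); rewrite sumQ -/(phi 0); ring.
Qed.

(** The map [g] stands for [lat] or [grk]. Each plane of [S] arises from the [q - 1] nonzero vectors
    of one point, so the count of [card_vectors] is divided by [q - 1]. *)
Lemma card_planes (g : 'rV[F]_4 -> {vspace 'rV[F]_6}) (S : {set Omega F 3}) :
  (forall x, x != 0 ->
     (\dim (g x) == 3%N) && totally_singular (@formK F) (g x)) ->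
  (forall x y, x != 0 -> y != 0 -> (g x == g y) = (<[x]>%VS == <[y]>%VS)) ->
  (forall pi, pi \in S -> exists2 x, x != 0 & val pi = g x) ->
  (forall pi x, x != 0 -> val pi = g x -> (pi \in S) = alpha (formQ x)) ->
  #|S|%:R = (q + 1) * (q * #|[set t | alpha t]|%:R + (alpha 0)%:R).
Proof.
move=> gP geq Sex Smem.
have q1 : 0 < q - 1 by rewrite subr_gt0 q_gt1.
apply: (mulfI (lt0r_neq0 q1)); rewrite mulrA.
have -> : (q - 1) * (q + 1) = q ^+ 2 - 1 by ring.
rewrite -card_vectors -[1]/(1%:R) -natrB ?(ltnW (finNzRing_gt1 F)) // -natrM.
congr (_%:R); rewrite mulnC -sum_nat_const -[RHS]sum1_card.
transitivity (\sum_(pi in S) \sum_(x : 'rV[F]_4 | x != 0%R) (val pi == g x))%N.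
  apply: eq_bigr => pi /Sex[y y0 piy].
  have := card_nonzero <[y]>; rewrite dim_vline y0 expn1 => <-.
  rewrite -sum1_card big_mkcond [RHS]big_mkcond /=; apply: eq_bigr => x _.
  rewrite !inE andbC; have [//|x0] := eqVneq x 0.
  rewrite piy geq // eq_sym /=; case: ifP => xy.
    by rewrite eqEdim -memvE xy !dim_vline x0 y0.
  by case: eqP => // yx; rewrite -yx memv_line in xy.
rewrite exchange_big /= [RHS]big_mkcond [LHS]big_mkcond /=; apply: eq_bigr => x _.
rewrite inE; have [//|x0] /= := eqVneq x 0.
pose pix : Omega F 3 := Sub (g x) (gP x x0).
case: ifP => ax.
  rewrite (bigD1 pix) /=; last by rewrite (Smem pix x x0).
  rewrite eqxx big1 // => pi /andP[_]; rewrite -val_eqE /=.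
  by move/negPf => ->.
rewrite big1 // => pi; case: eqP => // pi_x.
by rewrite (Smem pi x x0 pi_x) ax.
Qed.

End Core.

(** Common form of all the sets in the theorem: the sign in the condition on [B] is the one that
    [incidence_exists] produces on Greek planes. *)
Lemma CL_latin_greek (alpha : F -> bool) (A B : {set {vspace 'rV[F]_4}}) :
  square_invariant alpha ->
  A \subset pg_points F 4 -> B \subset pg_points F 4 ->
  (forall x, x != 0 -> (<[x]>%VS \in A) = alpha (formQ x)) ->
  (forall x, x != 0 -> (<[x]>%VS \in B) = alpha (- formQ x)) ->
  CL_with_parameter (latin_planes A :|: greek_planes B)
    (q * #|[set t | alpha t]|%:R + (alpha 0)%:R).
Proof.
move=> alpha_sqr /subsetP Apt /subsetP Bpt Aal Bal.
have latinP pi : reflect (exists x, [/\ x != 0, alpha (formQ x) & val pi = lat x])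
    (pi \in latin_planes A).
  rewrite inE; apply: (iffP exists_inP) => [[P PA]|[x [x0 ax pix]]].
    have /pg_pointsP[x x0 Px] := Apt P PA; rewrite Px is_latinE // => /eqP pix.
    by exists x; rewrite -Aal // -Px.
  by exists <[x]>%VS; rewrite ?Aal // is_latinE ?pix.
have greekP pi : reflect (exists x, [/\ x != 0, alpha (- formQ x) & val pi = grk x])
    (pi \in greek_planes B).
  rewrite inE; apply: (iffP exists_inP) => [[P PB]|[x [x0 ax pix]]].
    have /pg_pointsP[x x0 Px] := Bpt P PB; rewrite Px is_greekE // => /eqP pix.
    by exists x; rewrite -Bal // -Px.
  by exists <[x]>%VS; rewrite ?Bal // is_greekE ?pix.
have latin_mem pi x : x != 0 -> val pi = lat x ->
    (pi \in latin_planes A) = alpha (formQ x).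
  move=> x0 pix; apply/latinP/idP => [[y [y0 ay piy]]|ax]; last by exists x.
  rewrite -Aal //; suff -> : <[x]>%VS = <[y]>%VS by rewrite Aal.
  by apply/eqP; rewrite -lat_eq // -pix piy.
have greek_mem pi x : x != 0 -> val pi = grk x ->
    (pi \in greek_planes B) = alpha (- formQ x).
  move=> x0 pix; apply/greekP/idP => [[y [y0 ay piy]]|ax]; last by exists x.
  rewrite -Bal //; suff -> : <[x]>%VS = <[y]>%VS by rewrite Bal.
  by apply/eqP; rewrite -grk_eq // -pix piy.
have greekN pi x : x != 0 -> val pi = lat x -> pi \notin greek_planes B.
  move=> x0 pix; apply/greekP => -[y [y0 _ piy]].
  by have := lat_neq_grk x0 y0; rewrite -pix piy eqxx.
have latinN pi x : x != 0 -> val pi = grk x -> pi \notin latin_planes A.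
  move=> x0 pix; apply/latinP => -[y [y0 _ piy]].
  by have := lat_neq_grk y0 x0; rewrite -pix piy eqxx.
split.
  apply: limg_degree_one.
  have phi_sqr : square_invariant (fun t => (alpha t)%:R : R).
    by move=> c t c0; rewrite alpha_sqr.
  have [f fP] := incidence_exists phi_sqr.
  apply/memv_imgP; exists f; rewrite ?memvf // lfunE /=; apply/ffunP => pi.
  rewrite [LHS]ffunE inE; have [x x0 pix] := lat_or_grk pi.
  have [fl fg] := fP pi x x0; case: pix => pix.
    by rewrite (fl pix) (latin_mem pi x) // (negPf (greekN pi x x0 pix)) orbF.
  by rewrite (fg pix) (greek_mem pi x) // (negPf (latinN pi x x0 pix)).
have cardA : #|latin_planes A|%:R =
    (q + 1) * (q * #|[set t | alpha t]|%:R + (alpha 0)%:R).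
  apply: (@card_planes alpha (@lat F)) => //.
  - exact: latP.
  - exact: lat_eq.
  - by move=> pi /latinP[x [x0 _ pix]]; exists x.
have cardB : #|greek_planes B|%:R =
    (q + 1) * (q * #|[set t | alpha t]|%:R + (alpha 0)%:R).
  (* Negation permutes [F], so the condition on [- t] selects equally many values. *)
  have -> : #|[set t | alpha t]| = #|[set t | alpha (- t)]|.
    rewrite -(card_imset _ (@oppr_inj F)); apply: eq_card => t.
    rewrite inE -[t in LHS]opprK (mem_imset _ _ (@oppr_inj F)) inE //.
  have -> : alpha 0 = alpha (- 0) by rewrite oppr0.
  apply: (@card_planes (fun t => alpha (- t)) (@grk F)) => //.
  - exact: grkP.
  - exact: grk_eq.
  - by move=> pi /greekP[x [x0 _ pix]]; exists x.
(* No plane is both Latin and Greek, so the two cardinalities add up. *)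
rewrite /CL_parameter cardsU (_ : _ :&: _ = set0) ?cards0 ?subn0; last first.
  apply/setP => pi; rewrite !inE; apply/negP => /andP[].
  have := latinN pi; have := greekN pi; rewrite !inE => gN lN hl hg.
  have [x x0 [pix|pix]] := lat_or_grk pi.
    by have := gN x x0 pix; rewrite hg.
  by have := lN x x0 pix; rewrite hl.
rewrite natrD cardA cardB !big_ord_recl big_ord0 /= expr0 expr1 mulr1.
by field; have := q_gt1; lra.
Qed.

End Weights.

(** * Squares in a finite field of odd order *)

Section Squares.
Variable F : finFieldType.
Hypothesis F_odd : odd #|F|.
Local Notation m := (#|F|./2).

(** Translation by 1 permutes [F], so adding [#|F|] to the sum of all elements does not change
    it. *)
Lemma card_eq0 : #|F|%:R = 0 :> F.
Proof.
apply: (addIr (\sum_(t : F) t)); rewrite add0r -sumr_const -big_split /=.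
by rewrite [RHS](reindex_inj (addrI 1)).
Qed.

Lemma two_neq0 : 2 != 0 :> F.
Proof.
apply/eqP => two0; have := card_eq0; rewrite -(odd_double_half #|F|) F_odd.
by rewrite natrD -mul2n natrM two0 mul0r addr0; apply/eqP/oner_neq0.
Qed.

Lemma card_half : (#|F| = m.*2.+1)%N.
Proof. by rewrite -[LHS]odd_double_half F_odd. Qed.

Lemma half_gt0 : (0 < m)%N.
Proof. by rewrite -double_gt0 -ltnS -card_half finNzRing_gt1. Qed.

Lemma expf_double_half (t : F) : t != 0 -> t ^+ m.*2 = 1.
Proof.
move=> t0; apply: (mulfI t0); rewrite mulr1 -exprS -card_half.
exact: expf_card.
Qed.

Definition nonzero_square (t : F) := (t != 0) && is_square t.

Lemma nonzero_squareP t :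
  reflect (exists2 a, a != 0 & t = a ^+ 2) (nonzero_square t).
Proof.
apply: (iffP andP) => [[t0 /existsP[a /eqP at_]]|[a a0 ->]].
  by exists a => //; apply: contra_neq t0 => a0; rewrite -at_ a0 expr0n.
by rewrite expf_neq0 //; split=> //; apply/existsP; exists a.
Qed.

(** Squaring is two-to-one on nonzero elements, since [b] and [- b] differ. *)
Lemma card_nonzero_square : #|[set t | nonzero_square t]| = m.
Proof.
apply: double_inj; apply: succn_inj; rewrite -card_half [RHS](cardD1 (0 : F)).
rewrite inE add1n; congr _.+1; rewrite -[RHS]sum1_card.
rewrite (partition_big (fun a : F => a ^+ 2) nonzero_square) /=.
  rewrite -muln2 -sum_nat_const.
  apply: eq_big => [t|t]; first by rewrite inE.
  rewrite inE => /nonzero_squareP[b b0 ->]; rewrite sum1_card.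
  have bNb : b != - b.
    by rewrite -subr_eq0 opprK -mulr2n -mulr_natl mulf_neq0 ?two_neq0.
  transitivity #|[set b; - b]|; first by rewrite cards2 bNb.
  apply: eq_card => a; rewrite !inE unfold_in /= !inE eqf_sqr.
  case: eqP => [->|_] /=; rewrite ?b0 //.
  by case: eqP => [->|]; rewrite ?oppr_eq0 ?b0 ?andbF.
by move=> a /andP[a0 _]; apply/nonzero_squareP; exists a.
Qed.

Lemma card_nonsquare : #|[set t : F | ~~ is_square t]| = m.
Proof.
have := cardsC [set t : F | is_square t].
rewrite (cardsD1 0) inE (_ : is_square 0); last first.
  by apply/existsP; exists 0; rewrite expr0n.
rewrite (_ : _ :\ _ = [set t | nonzero_square t]); last first.
  by apply/setP => t; rewrite !inE.
rewrite card_nonzero_square (_ : ~: _ = [set t : F | ~~ is_square t]); last first.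
  by apply/setP => t; rewrite !inE.
by rewrite [in RHS]card_half; lia.
Qed.

(* Euler's criterion: the [m] nonzero squares are roots of ['X^m - 1]. *)
Lemma nonzero_squareE t : nonzero_square t = (t ^+ m == 1).
Proof.
have m0 := half_gt0.
have sub : [set t | nonzero_square t] \subset [set t : F | t ^+ m == 1].
  apply/subsetP => s; rewrite !inE => /nonzero_squareP[a a0 ->].
  by rewrite -exprM mul2n expf_double_half.
suff /setP/(_ t) : [set t | nonzero_square t] = [set t : F | t ^+ m == 1].
  by rewrite !inE.
apply/eqP; rewrite eqEcard sub card_nonzero_square.
pose p : {poly F} := 'X^m - 1.
have sp : size p = m.+1 by rewrite size_XnsubC.
rewrite cardE -ltnS -sp max_poly_roots ?enum_uniq -?size_poly_eq0 ?sp //.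
by apply/allP => a; rewrite mem_enum inE rootE !hornerE subr_eq0.
Qed.

Lemma expf_half (t : F) : t != 0 -> (t ^+ m == 1) || (t ^+ m == -1).
Proof.
by move=> t0; rewrite -eqf_sqr -exprM muln2 expr1n expf_double_half.
Qed.

Lemma one_neqN1 : 1 != -1 :> F.
Proof. by rewrite -subr_eq0 opprK two_neq0. Qed.

Lemma nonsquareE (t : F) : ~~ is_square t = (t ^+ m == -1).
Proof.
have [->|t0] := eqVneq t 0.
  have m0 := half_gt0.
  rewrite expr0n eqn0Ngt m0 /= eq_sym oppr_eq0 oner_eq0.
  by apply/negbF/existsP; exists 0; rewrite expr0n.
have -> : is_square t = (t ^+ m == 1) by rewrite -nonzero_squareE /nonzero_square t0.
have := expf_half t0; case: eqP => [->|_] //= _.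
by rewrite (negPf one_neqN1).
Qed.

Lemma nonzero_square_invariant : square_invariant nonzero_square.
Proof.
move=> c t c0; rewrite !nonzero_squareE exprMn.
suff -> : (c ^+ 2) ^+ m = 1 by rewrite mul1r.
by apply/eqP; rewrite -nonzero_squareE; apply/nonzero_squareP; exists c.
Qed.

Lemma nonsquare_invariant : square_invariant (fun t : F => ~~ is_square t).
Proof.
move=> c t c0; rewrite !nonsquareE exprMn.
suff -> : (c ^+ 2) ^+ m = 1 by rewrite mul1r.
by apply/eqP; rewrite -nonzero_squareE; apply/nonzero_squareP; exists c.
Qed.

Lemma zero_invariant : square_invariant (fun t : F => t == 0).
Proof. by move=> c t c0; rewrite mulf_eq0 expf_eq0 (negPf c0). Qed.

Lemma mem_square_points x : x != 0 ->
  (<[x]>%VS \in square_points F) = nonzero_square (formQ x).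
Proof.
move=> x0; rewrite !inE dim_vline x0 /=.
apply/existsP/idP => [[y /and3P[/eqP xy Qy0 Qy]]|]; last first.
  by case/andP=> Q0 Qx; exists x; rewrite eqxx Q0.
have : x \in <[y]>%VS by rewrite -xy memv_line.
case/vlineP => a xa; rewrite xa.
have -> : formQ (a *: y) = a ^+ 2 * formQ y by coords.
rewrite nonzero_square_invariant ?/nonzero_square ?Qy0 //.
by apply: contraNneq x0 => a0; rewrite xa a0 scale0r.
Qed.

Lemma mem_nonsquare_points x : x != 0 ->
  (<[x]>%VS \in nonsquare_points F) = ~~ is_square (formQ x).
Proof.
move=> x0; rewrite !inE dim_vline x0 /=.
apply/existsP/idP => [[y /andP[/eqP xy Qy]]|Qx]; last by exists x; rewrite eqxx.
have : x \in <[y]>%VS by rewrite -xy memv_line.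
case/vlineP => a xa; rewrite xa.
have -> : formQ (a *: y) = a ^+ 2 * formQ y by coords.
rewrite (@nonsquare_invariant a) //.
by apply: contraNneq x0 => a0; rewrite xa a0 scale0r.
Qed.

Lemma mem_quadric_points x : x != 0 ->
  (<[x]>%VS \in quadric_points F) = (formQ x == 0).
Proof.
move=> x0; rewrite !inE dim_vline x0 /=.
apply/forall_inP/eqP => [/(_ x (memv_line x))/eqP //|Qx _ /vlineP[a ->]].
have -> : formQ (a *: x) = a ^+ 2 * formQ x by coords.
by rewrite Qx mulr0.
Qed.

Lemma expN1_half_mod1 : (#|F| %% 4 = 1)%N -> (-1) ^+ m = 1 :> F.
Proof.
by move=> F1; rewrite -signr_odd (_ : odd m = false) //; lia.
Qed.

Lemma expN1_half_mod3 : (#|F| %% 4 = 3)%N -> (-1) ^+ m = -1 :> F.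
Proof.
by move=> F1; rewrite -signr_odd (_ : odd m = true) //; lia.
Qed.

End Squares.

Theorem theorem3p7 (q : nat) (F : finFieldType) (R : realType)
    (card_F : #|F| = q) (q_odd : odd q) :
  ((q = 1 %[mod 4])%N ->
     [/\ CL_with_parameter (S_l F :|: S_g F) (q%:R * (q%:R - 1) / 2 : R),
         CL_with_parameter (NS_l F :|: NS_g F) (q%:R * (q%:R - 1) / 2 : R)
       & CL_with_parameter (O_l F :|: O_g F) (q%:R + 1 : R)]) /\
  ((q = 3 %[mod 4])%N ->
     [/\ CL_with_parameter (S_l F :|: NS_g F) (q%:R * (q%:R - 1) / 2 : R),
         CL_with_parameter (S_g F :|: NS_l F) (q%:R * (q%:R - 1) / 2 : R)
       & CL_with_parameter (O_l F :|: O_g F) (q%:R + 1 : R)]).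
Proof.
subst q; have subS : square_points F \subset pg_points F 4.
  by apply/subsetP => P; rewrite inE => /andP[].
have subN : nonsquare_points F \subset pg_points F 4.
  by apply/subsetP => P; rewrite inE => /andP[].
have subQ : quadric_points F \subset pg_points F 4.
  by apply/subsetP => P; rewrite inE => /andP[].
have halfE : (#|F|./2)%:R = (#|F|%:R - 1) / 2 :> R.
  have := congr1 (fun n => n%:R : R) (card_half q_odd).
  by rewrite -muln2 -addn1 natrD natrM => ->; field.
have parS : #|F|%:R * #|[set t : F | nonzero_square t]|%:R
    + (nonzero_square (0 : F))%:R = #|F|%:R * (#|F|%:R - 1) / 2 :> R.
  by rewrite card_nonzero_square // halfE /nonzero_square eqxx addr0 mulrA.
have parN : #|F|%:R * #|[set t : F | ~~ is_square t]|%:R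
    + (~~ is_square (0 : F))%:R = #|F|%:R * (#|F|%:R - 1) / 2 :> R.
  rewrite card_nonsquare // halfE (_ : is_square 0) ?addr0 ?mulrA //.
  by apply/existsP; exists 0; rewrite expr0n.
have parQ : #|F|%:R * #|[set t : F | t == 0]|%:R + ((0 : F) == 0)%:R
    = #|F|%:R + 1 :> R.
  by rewrite (_ : [set t : F | t == 0] = [set 0]) ?cards1 ?mulr1 ?eqxx //;
     apply/setP => t; rewrite !inE.
(* The condition [t == 0] is stable under negation, so this serves both residues modulo 4. *)
have CLQ : CL_with_parameter (O_l F :|: O_g F) (#|F|%:R + 1 : R).
  rewrite -parQ; apply: CL_latin_greek => //; first exact: zero_invariant.
    exact: mem_quadric_points.
  by move=> x x0; rewrite oppr_eq0 mem_quadric_points.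
split=> q4; split=> //.
(* Here [-1] is a square, so [t] and [- t] satisfy the same condition. *)
- rewrite -parS; apply: CL_latin_greek => //; first exact: nonzero_square_invariant.
    by move=> x x0; rewrite mem_square_points.
  by move=> x x0; rewrite mem_square_points // !nonzero_squareE //
       exprNn expN1_half_mod1 ?mul1r.
- rewrite -parN; apply: CL_latin_greek => //; first exact: nonsquare_invariant.
    by move=> x x0; rewrite mem_nonsquare_points.
  by move=> x x0; rewrite mem_nonsquare_points // !nonsquareE //
       exprNn expN1_half_mod1 ?mul1r.
(* Here [-1] is a non-square, so negation exchanges nonzero squares and non-squares. *)
- rewrite -parS; apply: CL_latin_greek => //; first exact: nonzero_square_invariant.
    by move=> x x0; rewrite mem_square_points.
  move=> x x0; rewrite mem_nonsquare_points // nonsquareE // nonzero_squareE //.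
  by rewrite exprNn expN1_half_mod3 // mulN1r eqr_oppLR.
- rewrite setUC -parN; apply: CL_latin_greek => //; first exact: nonsquare_invariant.
    by move=> x x0; rewrite mem_nonsquare_points.
  move=> x x0; rewrite mem_square_points // nonsquareE // nonzero_squareE //.
  by rewrite exprNn expN1_half_mod3 // mulN1r eqr_opp.
Qed.
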